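(* Let $n \ge k \ge 1$ and $m \ge 1$ be integers. Let $K_1,\dots,K_m$ be nonempty (possibly overlapping) subsets of $[k]$ with $\bigcup_{i=1}^m K_i=[k]$, and let $N_1,\dots,N_m$ be nonempty pairwise disjoint subsets of $[n]$ with $\bigcup_{i=1}^m N_i=[n]$, such that $n_i=|N_i|\ge |K_i|=k_i$ for every $i\in[m]$. For $i\in[m]$ and $j\in N_i$ let $C_j=K_i$, and for each $i\in[k]$ let $R_i=\{j\in[n] : i\in C_j\}$. Put $$d_{\max} = 1+\min_{\varnothing\ne I\subseteq[k]}\Big\{\Big|\bigcup_{i\in I}R_i\Big|-|I|\Big\}.$$ Then every linear $\{N_i,K_i\}_{i=1}^m$-LEDC $\mathcal{C}$ over a finite field $\mathbb{F}_q$ has minimum distance $\mathsf{d}(\mathcal{C})\le d_{\max}$. Moreover, for all sufficiently large prime powers $q$, there exists a linear $\{N_i,K_i\}_{i=1}^m$-LEDC over $\mathbb{F}_q$ whose minimum distance equals $d_{\max}$.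
   Context: $[n]=\{1,\dots,n\}$. A linear $\{N_i,K_i\}_{i=1}^m$-LEDC (locally encodable and decodable code) over $\mathbb{F}_q$ is a linear map $\mathbb{F}_q^k\to\mathbb{F}_q^n$, $x=(x_1,\dots,x_k)\mapsto c=(c_1,\dots,c_n)=xG$, given by a $k\times n$ matrix $G$ over $\mathbb{F}_q$ (a generator matrix of the LEDC), such that for every $i\in[m]$: (P1) the coded symbols $\{c_j : j\in N_i\}$ depend only on the data symbols $\{x_j : j\in K_i\}$; (P2) the data symbols $\{x_j : j\in K_i\}$ are determined by any $k_i=|K_i|$ of the coded symbols $\{c_j : j\in N_i\}$. Its minimum distance $\mathsf{d}(\mathcal{C})$ is the minimum Hamming distance of the linear code $\{xG : x\in\mathbb{F}_q^k\}\subseteq\mathbb{F}_q^n$. *)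

(* Defs.v *)
From mathcomp Require Import all_boot all_order all_algebra.
Set Implicit Arguments.
Unset Strict Implicit.
Unset Printing Implicit Defensive.

Import Order.TTheory GRing.Theory Num.Theory.
Local Open Scope ring_scope.

Section Code.
Variables (F : finFieldType) (k n : nat).

Definition hamming_dist (u v : 'rV[F]_n) : nat := #|[set j | u 0 j != v 0 j]|.

(* Hamming distances are at most n, so the default value n of the minimum only
   matters when A has no two distinct words. *)
Definition min_dist (A : {set 'rV[F]_n}) : nat :=
  \big[minn/n]_(u in A) \big[minn/n]_(v in A | v != u) hamming_dist u v.

Definition code (G : 'M[F]_(k, n)) : {set 'rV[F]_n} :=
  [set x *m G | x : 'rV[F]_k].

Definition locally_encodable (Ki : {set 'I_k}) (Ni : {set 'I_n})
    (G : 'M[F]_(k, n)) : Prop :=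
  forall x y : 'rV[F]_k, (forall j, j \in Ki -> x 0 j = y 0 j) ->
  forall j, j \in Ni -> (x *m G) 0 j = (y *m G) 0 j.

Definition locally_decodable (Ki : {set 'I_k}) (Ni : {set 'I_n})
    (G : 'M[F]_(k, n)) : Prop :=
  forall S : {set 'I_n}, S \subset Ni -> #|S| = #|Ki| ->
  forall x y : 'rV[F]_k,
  (forall j, j \in S -> (x *m G) 0 j = (y *m G) 0 j) ->
  forall j, j \in Ki -> x 0 j = y 0 j.

Definition is_LEDC (m : nat) (K : 'I_m -> {set 'I_k}) (N : 'I_m -> {set 'I_n})
    (G : 'M[F]_(k, n)) : Prop :=
  forall i : 'I_m,
    locally_encodable (K i) (N i) G /\ locally_decodable (K i) (N i) G.

End Code.

Section Bound.
Variables (k n : nat) (C : 'I_n -> {set 'I_k}).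

Definition R_set (i : 'I_k) : {set 'I_n} := [set j | i \in C j].

(* The subtraction is taken in int, hence not truncated. For k >= 1 the default
   value n - k is harmless: I = [set: 'I_k] already contributes at most n - k. *)
Definition d_max : int :=
  1 + \big[Order.min/n%:Z - k%:Z]_(I : {set 'I_k} | I != set0)
        (#|\bigcup_(i in I) R_set i|%:Z - #|I|%:Z).

End Bound.

(* Main.v *)
Require Import Defs.
From mathcomp Require Import all_boot all_order all_algebra.
From mathcomp Require Import fingroup perm.
Set Implicit Arguments.
Unset Strict Implicit.
Unset Printing Implicit Defensive.

Import Order.TTheory GRing.Theory Num.Theory.
Local Open Scope ring_scope.

(** Upper bound: messages supported on I are encoded into words supported on
    the union U of the R_i for i in I, so by pigeonhole two of them agree on
    |I| - 1 positions of U.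

    Existence: take G_ij = t^(j n^i) when i is in C_j and 0 otherwise. A minor
    whose rows can be matched to its columns inside this support is a nonzero
    polynomial in t, and over a large field a single t avoids the roots of all
    of them. Local decodability is the nonvanishing of such minors. If x G and
    y G are at distance less than d_max, the definition of d_max is Hall's
    condition for matching all k rows into the columns where x G and y G agree,
    so the corresponding minor forces x = y. *)

(** * Hall's marriage theorem *)

(* Rado's proof: as long as some E i has two elements, one of them can be
   deleted from it without violating Hall's condition. *)
Lemma hall_marriage (I T : finType) (E : I -> {set T}) :
  (forall B : {set I}, (#|B| <= #|\bigcup_(i in B) E i|)%N) ->
  exists2 f : I -> T, injective f & forall i, f i \in E i.
Proof.
have [s] := ubnP (\sum_i #|E i|)%N; elim: s => // s IHs in E * => lesE hallE.
have [E1|/forallPn[i]] := boolP [forall i, #|E i| <= 1]%N.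
  have /fin_all_exists[f fE]: forall i, exists x, E i = [set x].
    move=> i; apply/cards1P; rewrite eqn_leq (forallP E1) /=.
    by rewrite -(cards1 i) (leq_trans (hallE _)) // big_set1.
  exists f => [i j eqf|i]; last by rewrite fE set11.
  apply/eqP; apply: contraLR (hallE [set i; j]) => neq_ij.
  by rewrite cards2 neq_ij bigcup_setU !big_set1 !fE eqf setUid cards1.
rewrite -ltnNge => /card_gt1P[x [y [xE yE neq_xy]]].
pose E' z j := if j == i then E i :\ z else E j.
have E'sub z j : E' z j \subset E j.
  by rewrite /E'; case: eqP => // ->; rewrite subD1set.
have reduce z : z \in E i ->
    (forall B : {set I}, (#|B| <= #|\bigcup_(j in B) E' z j|)%N) ->
    exists2 f : I -> T, injective f & forall i, f i \in E i.
  move=> zE /(IHs (E' z)) [|f injf fE].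
    rewrite -ltnS; apply: leq_trans lesE.
    rewrite ltnS (bigD1 i) //= [X in (_ < X)%N](bigD1 i) //=.
    rewrite -addSn leq_add //; first by rewrite /E' eqxx [ltnRHS](cardsD1 z) zE.
    by apply: leq_sum => j _; rewrite subset_leq_card.
  by exists f => // j; apply: (subsetP (E'sub z j)).
have [/forallP/(reduce x xE)//|/forallPn[B]] :=
  boolP [forall B : {set I}, #|B| <= #|\bigcup_(j in B) E' x j|]%N.
have [/forallP/(reduce y yE)//|/forallPn[D]] :=
  boolP [forall B : {set I}, #|B| <= #|\bigcup_(j in B) E' y j|]%N.
rewrite -!ltnNge => ltD ltB.
have i_in z (A : {set I}) : (#|\bigcup_(j in A) E' z j| < #|A|)%N -> i \in A.
  apply: contraLR => iA; rewrite -leqNgt (leq_trans (hallE A)) //.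
  rewrite (eq_bigr (E' z)) // => j jA; rewrite /E'.
  by case: eqP => // eqji; rewrite -eqji jA in iA.
have [iB iD] := (i_in _ _ ltB, i_in _ _ ltD).
set X := \bigcup_(j in B) _ in ltB; set Y := \bigcup_(j in D) _ in ltD.
(* Since [x != y], the set [X :|: Y] contains [E j] for all [j] in [B :|: D], also for [j = i]; and
   [X :&: Y] contains [E j] for [j] in [(B :&: D) :\ i]. Adding the two Hall bounds gives [#|B| +
   #|D| - 1 <= #|X| + #|Y| <= #|B| + #|D| - 2], absurd. *)
have leU : (#|B :|: D| <= #|X :|: Y|)%N.
  apply: leq_trans (hallE _) _; apply/subset_leq_card/bigcupsP => j jBD.
  apply/subsetP => z zE; have [eqji|neqji] := eqVneq j i.
    have [eqzx|neqzx] := eqVneq z x; apply/setUP; [right|left];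
      apply/bigcupP; exists i => //; rewrite /E' eqxx !inE -eqji zE andbT //.
    by rewrite eqzx.
  case/setUP: jBD => jBD; apply/setUP; [left|right];
    by apply/bigcupP; exists j; rewrite // /E' (negPf neqji).
have leI : (#|(B :&: D) :\ i| <= #|X :&: Y|)%N.
  apply: leq_trans (hallE _) _; apply/subset_leq_card/bigcupsP => j.
  rewrite !inE => /and3P[/negPf neqji jB jD]; rewrite subsetI.
  by apply/andP; split; apply/subsetP => z zE; apply/bigcupP; exists j;
     rewrite // /E' neqji.
have:= leq_add leU leI; rewrite cardsUI => leUI.
have:= cardsUI B D; rewrite [#|B :&: D|](cardsD1 i) inE iB iD /= => eqUI.
have := leq_trans (leq_add ltB ltD) _; rewrite -eqUI addSn !addnS => /(_ _ (leqnn _)).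
by rewrite add0n !ltnS leqNgt (leq_ltn_trans leUI).
Qed.

(** * Base expansions and degree bounds *)

Lemma digits_inj (B k : nat) (f g : 'I_k -> nat) :
  (forall i, f i < B)%N -> (forall i, g i < B)%N ->
  (\sum_i f i * B ^ i = \sum_i g i * B ^ i)%N -> f =1 g.
Proof.
elim: k f g => [|k IHk] f g ltf ltg; first by move=> _ [].
have B_gt0 : (0 < B)%N by apply: leq_ltn_trans (ltf ord0).
have tailE (h : 'I_k.+1 -> nat) : (\sum_i h i * B ^ i =
    h ord0 + (\sum_(i < k) h (lift ord0 i) * B ^ i) * B)%N.
  rewrite big_ord_recl expn0 muln1 big_distrl; congr (_ + _)%N.
  by apply: eq_bigr => i _; rewrite /= expnSr mulnA.
rewrite !tailE => eqfg.
have eq0 : f ord0 = g ord0.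
  have := congr1 (modn^~ B) eqfg.
  by rewrite /= ![(_ ord0 + _)%N]addnC !modnMDl !modn_small.
have /IHk eqS : (\sum_(i < k) f (lift ord0 i) * B ^ i =
    \sum_(i < k) g (lift ord0 i) * B ^ i)%N.
  by apply/eqP; rewrite -(eqn_pmul2r B_gt0) -(eqn_add2l (f ord0)) {2}eq0 eqfg.
by move=> i; have [j ->|->] := unliftP ord0 i; first exact: eqS.
Qed.

Lemma size_prod_bound (R : idomainType) (I : finType) (P : pred I)
    (p : I -> {poly R}) (d : nat) :
  (forall i, P i -> size (p i) <= d.+1)%N ->
  (size (\prod_(i | P i) p i)%R <= (#|I| * d).+1)%N.
Proof.
move=> szp; apply: leq_trans (size_prod_leq P p) _.
have: (\sum_(i | P i) size (p i) <= #|P| * d.+1)%N.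
  by rewrite -sum_nat_const; apply: leq_sum.
rewrite mulnS => szP; rewrite leq_subLR addnS ltnS (leq_trans szP) //.
by rewrite leq_add2l leq_mul2r max_card orbT.
Qed.

Lemma size_det_bound (R : idomainType) (k d : nat) (M : 'M[{poly R}]_k) :
  (forall i j, size (M i j) <= d.+1)%N -> (size (\det M) <= (k * d).+1)%N.
Proof.
move=> szM; apply: leq_trans (size_sum _ _ _) _; apply/bigmax_leqP => s _.
have := @size_prod_bound R _ xpredT (fun i => M i (s i)) d.
by rewrite size_Msign card_ord; apply.
Qed.

Lemma exists_nonroot (F : finFieldType) (p : {poly F}) :
  p != 0 -> (size p <= #|F|)%N -> exists t, ~~ root p t.
Proof.
move=> p_neq0 szp; apply/existsP; rewrite -negb_forall.
apply: contraL szp => /forallP rootp; rewrite -ltnNge cardE.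
by rewrite max_poly_roots ?enum_uniq //; apply/allP.
Qed.

(** * A generic matrix with prescribed support *)

Section GenericMatrix.
Variables (k n : nat) (C : 'I_n -> {set 'I_k}).

(** The zero pattern enforces local encodability; the exponent stores the column [j] as a base [n]
    digit in place [i]. *)
Definition moment_mx (R : nzRingType) (t : R) : 'M[R]_(k, n) :=
  \matrix_(i, j) if i \in C j then t ^+ (j * n ^ i) else 0.

(* Padding with the identity outside A turns the minor with rows A and columns
   f @: A into a determinant of fixed size k. *)
Definition padded_minor (R : nzRingType) (A : {set 'I_k}) (f : 'I_k -> 'I_n)
    (G : 'M[R]_(k, n)) : 'M[R]_k :=
  \matrix_(i, l) if (i \in A) && (l \in A) then G i (f l) else (i == l)%:R.

Lemma map_padded_minor_moment (R : comNzRingType) A f (t : R) :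
  map_mx (horner_eval t) (padded_minor A f (moment_mx 'X)) =
  padded_minor A f (moment_mx t).
Proof.
apply/matrixP => i l; rewrite !mxE /horner_eval.
by case: ifP; [case: ifP; rewrite ?hornerXn ?horner0 | case: eqP; rewrite ?hornerC].
Qed.

(* The exponents of t have base n digits f (s i), so distinct permutations s
   contribute distinct monomials. *)
Lemma det_padded_minor_neq0 (F : fieldType) (A : {set 'I_k}) (f : 'I_k -> 'I_n) :
  {in A &, injective f} -> (forall i, i \in A -> i \in C (f i)) ->
  \det (padded_minor A f (moment_mx ('X : {poly F}))) != 0.
Proof.
move=> injf fC; set M := padded_minor _ _ _.
(* Rows outside [A] contribute a factor 1 from the identity padding, hence the digit 0. *)
pose dg (s : 'S_k) i := if i \in A then f (s i) : nat else 0%N.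
have dg_lt s i : (dg s i < n)%N.
  by rewrite /dg; case: ifP => // _; apply: leq_ltn_trans (ltn_ord (f i)).
pose e s := (\sum_i dg s i * n ^ i)%N.
(* A term can be nonzero only if [s] preserves [A] and fixes its complement pointwise. *)
have prodM (s : 'S_k) : (forall i, M i (s i) != 0) ->
    \prod_i M i (s i) = 'X^(e s) /\ forall i, i \notin A -> s i = i.
  move=> M_neq0.
  have sA i : (s i \in A) = (i \in A).
    have := M_neq0 i; rewrite mxE.
    case: (i =P s i) => [<-//|_] /=; case: ifP => [/andP[-> ->]//|_].
    by rewrite eqxx.
  have sN i : i \notin A -> s i = i.
    move=> /negPf iA; have := M_neq0 i; rewrite mxE iA.
    by case: (i =P s i) => //= _; rewrite eqxx.
  split=> //; rewrite expr_sum; apply: eq_bigr => i _.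
  have := M_neq0 i; rewrite /dg !mxE sA andbb; case: ifP => [_|/negbT/sN->].
    by case: ifP; rewrite ?eqxx.
  by rewrite eqxx.
have M1_neq0 i : M i ((1%g : 'S_k) i) != 0.
  rewrite perm1 !mxE andbb; have [iA|_] := boolP (i \in A).
    by rewrite fC // expf_neq0 // polyX_eq0.
  by rewrite eqxx oner_eq0.
(* The monomial of the identity is isolated: any other [s] yields 0 or, by uniqueness of digits and
   injectivity of [f] on [A], another exponent. *)
apply/eqP => /(congr1 (fun p : {poly F} => p`_(e 1%g)))/eqP; apply/negP.
rewrite coef0 /determinant coef_sum (bigD1 1%g) //= [X in _ + X]big1 ?addr0.
  by rewrite odd_perm1 mul1r (prodM _ M1_neq0).1 coefXn eqxx oner_eq0.
move=> s s_neq1; suff coef0s : (\prod_i M i (s i))`_(e 1%g) = 0.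
  by case: (odd_perm s); rewrite ?(expr1, expr0, mul1r, mulN1r, coefN) coef0s ?oppr0.
have [/forallP M_neq0|] := boolP [forall i, M i (s i) != 0]; last first.
  by case/forallPn => i /negPn/eqP Mi0; rewrite (bigD1 i) //= Mi0 mul0r coef0.
have [-> sN] := prodM s M_neq0; rewrite coefXn; case: eqP => // eqe.
case/eqP: s_neq1; apply/permP => i; rewrite perm1.
have [iA|/sN//] := boolP (i \in A).
have := digits_inj (dg_lt _) (dg_lt _) eqe i; rewrite /dg iA perm1.
move/val_inj => eqf; apply: injf => //.
have := M_neq0 i; rewrite mxE iA; case: (i =P s i) => [<-//|_] /=.
by case: ifP; rewrite ?eqxx.
Qed.

Lemma exists_generic_point : exists q0 : nat, forall F : finFieldType,
  (q0 <= #|F|)%N -> exists t : F,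
  forall (A : {set 'I_k}) (f : {ffun 'I_k -> 'I_n}),
  {in A &, injective f} -> (forall i, i \in A -> i \in C (f i)) ->
  \det (padded_minor A f (moment_mx t)) != 0.
Proof.
pose T := ({set 'I_k} * {ffun 'I_k -> 'I_n})%type.
(* The number of pairs [(A, f)] times a degree bound for each determinant, whose entries have degree
   at most [n * n ^ k]; the successor turns degree into [size]. *)
exists (#|{: T}| * (k * (n * n ^ k))).+1 => F leF.
pose p (Af : T) : {poly F} := \det (padded_minor Af.1 Af.2 (moment_mx 'X)).
have szp Af : (size (p Af) <= (k * (n * n ^ k)).+1)%N.
  apply: size_det_bound => i l; rewrite !mxE.
  case: ifP => _; last by case: eqP; rewrite ?size_poly1 ?size_poly0.
  case: ifP => _; last by rewrite size_poly0.
  have n_gt0 : (0 < n)%N := leq_ltn_trans (leq0n _) (ltn_ord (Af.2 l)).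
  rewrite size_polyXn ltnS; apply: leq_mul; first exact/ltnW/ltn_ord.
  by rewrite leq_pexp2l // ltnW.
have [||t] := @exists_nonroot F (\prod_(Af : T | p Af != 0) p Af).
- by rewrite prodf_seq_neq0; apply/allP => Af _; apply/implyP.
- by apply: leq_trans leF; apply: size_prod_bound => Af _; apply: szp.
rewrite /root horner_prod prodf_seq_neq0 => /allP nroot.
exists t => A f injf fC.
have /= := nroot (A, f) (mem_index_enum _).
rewrite det_padded_minor_neq0 //=.
by rewrite -map_padded_minor_moment det_map_mx.
Qed.

End GenericMatrix.

(** [x] is itself a left null vector of the padded minor: columns in [A] produce entries of
    [x *m G], identity columns produce entries of [x] outside [A]. *)
Lemma padded_minor_kernel (F : fieldType) (k n : nat) (A : {set 'I_k})
    (f : 'I_k -> 'I_n) (G : 'M[F]_(k, n)) (x : 'rV_k) :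
  \det (padded_minor A f G) != 0 -> (forall i, i \notin A -> x 0 i = 0) ->
  (forall i, i \in A -> (x *m G) 0 (f i) = 0) -> x = 0.
Proof.
move=> det_neq0 xA xG; apply: contraNeq det_neq0 => x_neq0.
apply/det0P; exists x => //; apply/rowP => l; rewrite [RHS]mxE.
have [lA|lA] := boolP (l \in A).
  rewrite -(xG l lA) !mxE; apply: eq_bigr => i _; rewrite !mxE lA andbT.
  by case: ifP => // /negbT/xA->; rewrite !mul0r.
rewrite mxE big1 // => i _; rewrite mxE (negPf lA) andbF.
by case: eqP => [->|_]; [rewrite xA ?mul0r|rewrite mulr0].
Qed.

Lemma mul_moment_mx (R : nzRingType) (k n : nat) (C : 'I_n -> {set 'I_k})
    (t : R) (x y : 'rV[R]_k) j :
  (forall i, i \in C j -> x 0 i = y 0 i) ->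
  (x *m moment_mx C t) 0 j = (y *m moment_mx C t) 0 j.
Proof.
move=> eqxy; rewrite !mxE; apply: eq_bigr => i _; rewrite mxE.
by case: ifP => [/eqxy->|_]; rewrite ?mulr0.
Qed.

(** * Minimum distance as an iterated minimum *)

Section MinDist.
Variables (F : finFieldType) (n : nat) (A : {set 'rV[F]_n}).

Lemma min_dist_le u v :
  u \in A -> v \in A -> v != u -> (min_dist A <= hamming_dist u v)%N.
Proof.
move=> uA vA neq_vu.
(* minn is convertible to Order.min on nat. *)
apply: (@Order.TotalTheory.bigmin_inf _ nat _ n u) => //.
by apply: (@Order.TotalTheory.bigmin_inf _ nat _ n v) => //; rewrite vA.
Qed.

(** The bound [d <= n] takes care of the default value [n] of both minima. *)
Lemma min_dist_ge (d : nat) : (d <= n)%N ->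
  (forall u v, u \in A -> v \in A -> v != u -> d <= hamming_dist u v)%N ->
  (d <= min_dist A)%N.
Proof.
move=> led leA; apply: (@Order.POrderTheory.le_bigmin _ nat) => // u uA.
by apply: (@Order.POrderTheory.le_bigmin _ nat) => // v /andP[]; apply: leA.
Qed.

End MinDist.

(** * The upper bound on the distance *)

Section UpperBound.
Variables (k n m : nat) (K : 'I_m -> {set 'I_k}) (N : 'I_m -> {set 'I_n}).
Hypothesis K_cover : \bigcup_i K i = [set: 'I_k].
Hypothesis N_cover : \bigcup_i N i = [set: 'I_n].
Hypothesis K_le_N : forall i, (#|K i| <= #|N i|)%N.
Variable C : 'I_n -> {set 'I_k}.
Hypothesis C_def : forall i j, j \in N i -> C j = K i.
Variables (F : finFieldType) (G : 'M[F]_(k, n)).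
Hypothesis G_LEDC : is_LEDC K N G.

(** Every data symbol lies in some [K i], and [N i] has enough positions to recover it by local
    decodability. *)
Lemma LEDC_inj (x y : 'rV[F]_k) : x *m G = y *m G -> x = y.
Proof.
move=> eqxy; apply/rowP => l.
have /bigcupP[i _ lK] : l \in \bigcup_i K i by rewrite K_cover inE.
have /card_geqP[s [uniq_s size_s sN]] := K_le_N i.
apply: (G_LEDC i).2 [set j in s] _ _ _ _ _ _ lK => [||j _]; last by rewrite eqxy.
  by apply/subsetP => j; rewrite inE; apply: sN.
by rewrite cardsE (card_uniqP uniq_s).
Qed.

(* Pigeonhole: among the |F|^|I| messages supported on I, two have encodings
   that agree on T. *)
Lemma LEDC_close_codewords (I : {set 'I_k}) (T : {set 'I_n}) :
  (#|T| < #|I|)%N ->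
  exists u v, [/\ u \in code G, v \in code G, v != u &
    (hamming_dist u v <= #|\bigcup_(i in I) R_set C i :\: T|)%N].
Proof.
move=> ltTI.
pose D := pffun_on (0 : F) I predT.
pose msg (x : {ffun 'I_k -> F}) : 'rV[F]_k := \row_i x i.
pose h (x : {ffun 'I_k -> F}) :=
  [ffun j => if j \in T then (msg x *m G) 0 j else 0].
have /dinjectivePn[x xD [y]] : ~~ dinjectiveb h D.
  apply: contraL (ltTI) => /dinjectiveP/card_in_image imD; rewrite -leqNgt.
  have: (#|[seq h x | x in D]| <= #|pffun_on 0%R T (@predT F)|)%N.
    apply/subset_leq_card/subsetP => _ /imageP[x _ ->].
    apply/pffun_onP; split=> //; apply/supportP => j /negPf jT.
    by rewrite ffunE jT.
  rewrite imD !card_pffun_on leq_exp2l //.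
  exact: (card_finNzRing_gt1 F).
rewrite !inE => /andP[neq_yx yD] eqh.
exists (msg x *m G), (msg y *m G); split; try by apply/imsetP; eexists.
  apply: contra neq_yx => /eqP/LEDC_inj eqyx; apply/eqP/ffunP => i.
  by have := congr1 (fun z : 'rV_k => z 0 i) eqyx; rewrite !mxE.
apply/subset_leq_card/subsetP => j; rewrite !inE => neq_j.
have jT : j \notin T.
  apply: contra neq_j => jT; have := congr1 (fun z : {ffun _} => z j) eqh.
  by rewrite !ffunE jT => ->.
(* Outside the union, [C j] misses [I], so the coded symbol sees only data symbols where both
   messages vanish. *)
rewrite jT; apply: contraR neq_j => jU.
have /bigcupP[i _ jN] : j \in \bigcup_i N i by rewrite N_cover inE.
apply/eqP; apply: (G_LEDC i).1 (jN) => l lK; rewrite !mxE.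
have lI : l \notin I.
  apply: contra jU => lI; apply/bigcupP; exists l => //.
  by rewrite inE (C_def jN).
have [/pffun_onP[/supportP x0 _] /pffun_onP[/supportP y0 _]] := (xD, yD).
by rewrite x0 ?y0.
Qed.

Lemma LEDC_min_dist_le (I : {set 'I_k}) : I != set0 ->
  (min_dist (code G))%:Z <= 1 + (#|\bigcup_(i in I) R_set C i|%:Z - #|I|%:Z).
Proof.
rewrite -card_gt0 => I_gt0; set U := \bigcup_(i in I) _.
(* If [#|U| < #|I|], taking [T := U] gives distinct codewords at distance 0, absurd. Otherwise [T]
   consists of [#|I| - 1] positions of [U]. *)
have [ltUI|leIU] := ltnP #|U| #|I|.
  have [u [v [uG vG neq_vu]]] := LEDC_close_codewords ltUI.
  rewrite setDv cards0 leqn0 cards_eq0 => /eqP/setP eq0.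
  case/eqP: neq_vu; apply/rowP => j; have := eq0 j.
  by rewrite !inE => /negbFE/eqP.
have /card_geqP[s [uniq_s size_s sU]] : (#|I|.-1 <= #|U|)%N.
  by rewrite (leq_trans (leq_pred _)).
have card_s : #|[set j in s]| = #|I|.-1 by rewrite cardsE (card_uniqP uniq_s).
have [|u [v [uG vG neq_vu led]]] := @LEDC_close_codewords I [set j in s].
  by rewrite card_s prednK.
have := leq_trans (min_dist_le uG vG neq_vu) led.
rewrite cardsDS ?card_s; last by apply/subsetP => j; rewrite inE; apply: sU.
move: I_gt0 leIU; case: #|I| => // c _ ltcU.
rewrite -lez_nat -subzn 1?ltnW // => /le_trans; apply.
by rewrite intS opprD addrCA addNKr.
Qed.

Lemma LEDC_min_dist_le_d_max : (0 < k)%N -> (min_dist (code G))%:Z <= d_max C.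
Proof.
(* The default value [n - k] of the minimum is handled by [I = [set: 'I_k]], whose union has at most
   [n] elements. *)
move=> k_gt0; rewrite -lerBlDl; apply/Order.TotalTheory.bigmin_geP; split=> [|I I_neq0].
  have setT_neq0 : [set: 'I_k] != set0 by rewrite -card_gt0 cardsT card_ord.
  rewrite lerBlDl; apply: le_trans (LEDC_min_dist_le setT_neq0) _.
  by rewrite cardsT card_ord lerD2l lerD2r lez_nat -[leqRHS]card_ord max_card.
by rewrite lerBlDl LEDC_min_dist_le.
Qed.

End UpperBound.

(** * Attaining the bound over large fields *)

Theorem theorem2 (k n m : nat) (hk : (1 <= k)%N) (hkn : (k <= n)%N)
    (hm : (1 <= m)%N)
    (K : 'I_m -> {set 'I_k}) (N : 'I_m -> {set 'I_n})
    (K_neq0 : forall i, K i != set0)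
    (K_cover : \bigcup_i K i = [set: 'I_k])
    (N_neq0 : forall i, N i != set0)
    (N_disj : forall i j, i != j -> [disjoint N i & N j])
    (N_cover : \bigcup_i N i = [set: 'I_n])
    (K_le_N : forall i, (#|K i| <= #|N i|)%N)
    (C : 'I_n -> {set 'I_k})
    (C_def : forall i j, j \in N i -> C j = K i) :
  (forall (F : finFieldType) (G : 'M[F]_(k, n)),
     is_LEDC K N G -> (min_dist (code G))%:Z <= d_max C) /\
  (exists q0 : nat, forall F : finFieldType, (q0 <= #|F|)%N ->
     exists G : 'M[F]_(k, n),
       is_LEDC K N G /\ (min_dist (code G))%:Z = d_max C).
Proof.
have le_d_max (F : finFieldType) (G : 'M[F]_(k, n)) :
    is_LEDC K N G -> (min_dist (code G))%:Z <= d_max C.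
  by move=> G_LEDC; apply: (LEDC_min_dist_le_d_max K_cover N_cover K_le_N C_def).
split=> [F G|]; first exact: le_d_max.
have [q0 generic] := exists_generic_point C; exists q0 => F /generic[t det_neq0].
pose G := moment_mx C t; exists G.
have minor_kernel (A : {set 'I_k}) (f : 'I_k -> 'I_n) (x : 'rV_k) :
    {in A &, injective f} -> (forall i, i \in A -> i \in C (f i)) ->
    (forall i, i \notin A -> x 0 i = 0) ->
    (forall i, i \in A -> (x *m G) 0 (f i) = 0) -> x = 0.
  move=> injf fC xA xG; apply: (@padded_minor_kernel _ _ _ A (finfun f) G) => //.
  - apply: det_neq0 => [i j iA jA|i iA]; rewrite !ffunE; last exact: fC.
    exact: injf.
  - by move=> i iA; rewrite ffunE xG.
have G_LEDC : is_LEDC K N G.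
  move=> i; split=> [x y eqxy j jN|S SN cardS x y eqxy l lK].
    by apply: mul_moment_mx => l; rewrite (C_def _ _ jN); apply: eqxy.
  have /card_gt0P[j0 _] : (0 < #|S|)%N by rewrite cardS card_gt0.
  (* [f] pairs [K i] with [S] by rank; [z] below is [x - y] cut down to [K i], which the columns in
     [S] cannot distinguish from [x - y]. *)
  pose f l := nth j0 (enum S) (index l (enum (K i))).
  have fS l' : l' \in K i -> f l' \in S.
    move=> l'K; rewrite -mem_enum mem_nth // -cardE cardS cardE index_mem.
    by rewrite mem_enum.
  pose z : 'rV_k := \row_l' if l' \in K i then x 0 l' - y 0 l' else 0.
  have /rowP/(_ l) : z = 0; last by rewrite !mxE lK => /eqP; rewrite subr_eq0 => /eqP.
  apply: (minor_kernel (K i) f) => [l1 l2 l1K l2K /eqP|l' l'K|l' /negPf l'K|l' l'K].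
  - rewrite nth_uniq ?enum_uniq // -?cardE ?cardS ?cardE ?index_mem ?mem_enum //.
    by move/eqP/(congr1 (nth l1 (enum (K i)))); rewrite !nth_index ?mem_enum.
  - by rewrite (C_def i) // (subsetP SN) ?fS.
  - by rewrite mxE l'K.
  - transitivity (((x - y) *m G) 0 (f l')).
      apply: mul_moment_mx => l1; rewrite (C_def i) ?(subsetP SN) ?fS // => l1K.
      by rewrite !mxE l1K.
    by rewrite mulmxBl [LHS]mxE [X in _ + X]mxE eqxy ?fS ?subrr.
split=> //; apply/le_anti; rewrite le_d_max //=.
have d_max_le (I : {set 'I_k}) : I != set0 ->
    d_max C <= 1 + (#|\bigcup_(i in I) R_set C i|%:Z - #|I|%:Z).
  by move=> I_neq0; rewrite lerD2l; apply: Order.TotalTheory.bigmin_le_cond.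
(* Required by the default value [n] in [min_dist]; it follows from the default [n - k] in [d_max]
   and [1 <= k]. *)
have d_max_len : d_max C <= n%:Z.
  apply: le_trans (_ : 1 + (n%:Z - k%:Z) <= _).
    by rewrite lerD2l; apply: Order.TotalTheory.bigmin_le_id.
  by rewrite addrCA gerDl subr_le0 lez_nat.
case: (d_max C) d_max_len d_max_le => // d len d_le; rewrite lez_nat.
apply: min_dist_ge => // _ _ /imsetP[x _ ->] /imsetP[y _ ->] neq_yx.
rewrite leqNgt; apply: contra neq_yx => lt_d; apply/eqP.
congr (_ *m _); apply/esym/subr0_eq.
pose Z := [set j | (x *m G) 0 j == (y *m G) 0 j].
(* Hall's condition: [U] is covered by [V] and the positions of disagreement, so [d + #|B| <= #|U| +
   1 <= #|V| + hamming_dist (x *m G) (y *m G) + 1 <= #|V| + d]. *)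
have [B|f injf fE] := @hall_marriage _ _ (fun i => R_set C i :&: Z).
  have [->|B_neq0] := eqVneq B set0; first by rewrite cards0.
  have := d_le B B_neq0; set U := \bigcup_(i in B) R_set C i.
  set V := \bigcup_(i in B) _.
  rewrite addrA lerBrDr -intS -PoszD lez_nat => led.
  have: (#|U| <= #|V| + hamming_dist (x *m G) (y *m G))%N.
    apply: leq_trans (leq_card_setU _ _); apply/subset_leq_card/subsetP => j.
    move=> /bigcupP[i iB jR]; rewrite !inE orbC -implybE; apply/implyP => jZ.
    by apply/bigcupP; exists i; rewrite //= in_setI jR inE.
  rewrite -ltnS => leU; rewrite -(leq_add2l d) (leq_trans led) // (leq_trans leU) //.
  by rewrite -addnS addnC leq_add2r.
apply: (minor_kernel setT f) => [i j _ _ /injf //|i _|i|i _].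
- by have := fE i; rewrite !inE => /andP[].
- by rewrite inE.
- rewrite mulmxBl [LHS]mxE [X in _ + X]mxE.
  by have := fE i; rewrite !inE => /andP[_ /eqP->]; rewrite subrr.
Qed.
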